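(* Let $F$ be a field and let $B$ be a ring with $1\neq 0$ having a left primitive linear character $\mu:B^+\to F^*$. Suppose that either $2\in U(B)$ or $2\in J(B)$, and let $f(t)=t^2+ct+d\in B[t]$ be an arbitrary polynomial subject only to: - $c$ and $d$ are central in $B$; - $c=0$ and $d\in U(B)$ if $2\in U(B)$; - $c\in U(B)$ if $2\in J(B)$. Let $A=B[t]/(f(t))=B[\gamma]$, where $\gamma=t+(f(t))$. Then: (a) $A$ is a free (left and right) $B$-module with basis $\{1,\gamma\}$. (b) There is a unique involution $*$ of $A$, of order 2, extending the identity map $1_B$ of $B$ and satisfying $\gamma^*=-(c+\gamma)$. (c) The linear character $\lambda:A^+\to F^*$ given by $\lambda(a+b\gamma)=\mu(a)$, $a,b\in B$, is left admissible (with respect to the involution $*$ of (b)). (d) The map $\Lambda:A\to B$ given by $\alpha\mapsto\alpha+\alpha^*$ is surjective.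
   Context: $U(B)$ and $J(B)$ denote the unit group and the Jacobson radical of $B$. An involution of a ring is an anti-automorphism of order $\le 2$. A linear character of a ring $B$ is a group homomorphism $B^+\to F^*$ from the additive group of $B$ to the multiplicative group of the field $F$. It is left primitive if its kernel contains no left ideals of $B$ other than $(0)$. For a ring $A$ with involution $*$, a linear character $\lambda:A^+\to F^*$ is left admissible if the kernel of the linear character $\lambda^\sharp:A^+\to F^*$, $\lambda^\sharp(\alpha)=\lambda(\alpha+\alpha^* )$, contains no left ideals of $A$ other than $(0)$.
   Formalization: In (b), B is assumed commutative, since an anti-automorphism of A fixing B pointwise forces xy=yx on B (so (b) fails e.g. for B=M_2(F_3), f=t^2+1); (c) and (d) are stated for every involution * as in (b). *)

(* Defs.v *)
From HB Require Import structures.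
From mathcomp Require Import all_boot all_order all_algebra.
From mathcomp Require Import generic_quotient ring_quotient.

Set Implicit Arguments.
Unset Strict Implicit.
Unset Printing Implicit Defensive.

Import GRing.Theory Pdiv.Ring Pdiv.RingMonic.

Local Open Scope ring_scope.

Definition central (R : nzRingType) (x : R) : Prop :=
  forall y : R, GRing.comm x y.

Definition left_ideal (R : nzRingType) (I : R -> Prop) : Prop :=
  [/\ I 0, forall x y, I x -> I y -> I (x + y) & forall a x, I x -> I (a * x)].

Definition maximal_left_ideal (R : nzRingType) (M : R -> Prop) : Prop :=
  [/\ left_ideal M, ~ M 1 &
      forall I : R -> Prop, left_ideal I -> ~ I 1 ->
        (forall x, M x -> I x) -> forall x, I x -> M x].

Definition jacobson_radical (R : nzRingType) (x : R) : Prop :=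
  forall M : R -> Prop, maximal_left_ideal M -> M x.

Definition linear_character (R : nzRingType) (F : fieldType) (mu : R -> F) :
    Prop :=
  (forall x, mu x != 0) /\ {morph mu : x y / x + y >-> x * y}.

Definition kernel_without_left_ideals (R : nzRingType) (F : fieldType)
    (mu : R -> F) : Prop :=
  forall I : R -> Prop, left_ideal I -> (forall x, I x -> mu x = 1) ->
    forall x, I x -> x = 0.

Definition left_primitive (R : nzRingType) (F : fieldType) (mu : R -> F) :
    Prop :=
  linear_character mu /\ kernel_without_left_ideals mu.

Definition involution (R : nzRingType) (s : R -> R) : Prop :=
  [/\ {morph s : x y / x + y}, s 1 = 1,
      {morph s : x y / x * y >-> y * x} & involutive s].

Definition sharp (R : nzRingType) (F : fieldType) (s : R -> R) (lam : R -> F)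
    (x : R) : F :=
  lam (x + s x).

Definition left_admissible (R : nzRingType) (F : fieldType) (s : R -> R)
    (lam : R -> F) : Prop :=
  linear_character lam /\ kernel_without_left_ideals (sharp s lam).

(* An involution cannot fix pointwise a noncommutative subring. *)
Lemma involution_fix_comm (B A : nzRingType) (i : {rmorphism B -> A})
    (s : A -> A) :
  injective i -> involution s -> (forall b, s (i b) = i b) ->
  commutative ( *%R : B -> B -> B).
Proof.
move=> i_inj [_ _ sM _] si x y; apply: i_inj.
by rewrite rmorphM -[LHS]/(i x * i y) -{1}(si x) -{1}(si y) -sM -rmorphM si.
Qed.

(* The library's [idealr] is a proper ideal closed under multiplication by
   arbitrary elements on the left, and its quotients are only rings when the
   ambient ring is commutative; hence the quotient by a two-sided ideal. *)
Section TwoSidedQuotient.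

Variables (R : nzRingType) (I : idealr R).
Hypothesis I_right : forall a u, u \in I -> u * a \in I.

Definition ring_quot of (forall a u, u \in I -> u * a \in I) : Type :=
  Quotient.quot I.

Local Notation Q := (ring_quot I_right).
Local Notation Q0 := (Quotient.quot I).

HB.instance Definition _ := GRing.Zmodule.on Q.

Definition ring_quot_proj (x : R) : Q := (\pi_Q0 x)%qT.

Definition ring_quot_one : Q := ring_quot_proj 1.

Definition ring_quot_mul (x y : Q) : Q :=
  ring_quot_proj (repr (x : Q0) * repr (y : Q0)).

Lemma ring_quot_projP (x y : R) :
  reflect (ring_quot_proj x = ring_quot_proj y) (x - y \in I).
Proof. by rewrite Quotient.idealrBE; apply: eqP. Qed.

Lemma ring_quot_ind (P : Q -> Prop) :
  (forall x, P (ring_quot_proj x)) -> forall q, P q.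
Proof. by move=> Pp q; rewrite -[q](@reprK _ Q0). Qed.

Fact ring_quot_projD : {morph ring_quot_proj : x y / x + y}.
Proof. exact: (raddfD (\pi_Q0)%qT). Qed.

Fact ring_quot_projM (x y : R) :
  ring_quot_proj (x * y) = ring_quot_mul (ring_quot_proj x) (ring_quot_proj y).
Proof.
apply/ring_quot_projP.
set x' := repr _; set y' := repr _.
have xx' : x - x' \in I by apply/ring_quot_projP/esym/(@reprK _ Q0).
have yy' : y - y' \in I by apply/ring_quot_projP/esym/(@reprK _ Q0).
rewrite -(subrKA (x * y')) -mulrBr -mulrBl.
by apply: rpredD; [apply: idealMr | apply: I_right].
Qed.

Fact ring_quot_mulA : associative ring_quot_mul.
Proof.
elim/ring_quot_ind=> x; elim/ring_quot_ind=> y; elim/ring_quot_ind=> z.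
by rewrite -!ring_quot_projM mulrA.
Qed.

Fact ring_quot_mul1 : left_id ring_quot_one ring_quot_mul.
Proof. by elim/ring_quot_ind=> x; rewrite -ring_quot_projM mul1r. Qed.

Fact ring_quot_mulr1 : right_id ring_quot_one ring_quot_mul.
Proof. by elim/ring_quot_ind=> x; rewrite -ring_quot_projM mulr1. Qed.

Fact ring_quot_mulDl : left_distributive ring_quot_mul +%R.
Proof.
elim/ring_quot_ind=> x; elim/ring_quot_ind=> y; elim/ring_quot_ind=> z.
by rewrite -ring_quot_projD -!ring_quot_projM mulrDl ring_quot_projD.
Qed.

Fact ring_quot_mulDr : right_distributive ring_quot_mul +%R.
Proof.
elim/ring_quot_ind=> x; elim/ring_quot_ind=> y; elim/ring_quot_ind=> z.
by rewrite -ring_quot_projD -!ring_quot_projM mulrDr ring_quot_projD.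
Qed.

Fact ring_quot_proj0 : ring_quot_proj 0 = 0.
Proof. exact: (raddf0 (\pi_Q0)%qT). Qed.

Fact ring_quot_1neq0 : ring_quot_one != 0.
Proof.
apply/eqP; rewrite -ring_quot_proj0 => /ring_quot_projP.
by rewrite subr0 idealr1.
Qed.

HB.instance Definition _ := GRing.Zmodule_isNzRing.Build Q
  ring_quot_mulA ring_quot_mul1 ring_quot_mulr1 ring_quot_mulDl ring_quot_mulDr
  ring_quot_1neq0.

Fact ring_quot_proj_zmod : zmod_morphism ring_quot_proj.
Proof. exact: (raddfB (\pi_Q0)%qT). Qed.

Fact ring_quot_proj_monoid : monoid_morphism ring_quot_proj.
Proof. by split=> // x y; apply: ring_quot_projM. Qed.

HB.instance Definition _ :=
  GRing.isZmodMorphism.Build R Q ring_quot_proj ring_quot_proj_zmod.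
HB.instance Definition _ :=
  GRing.isMonoidMorphism.Build R Q ring_quot_proj ring_quot_proj_monoid.

End TwoSidedQuotient.

Section QuadraticExtension.

Variables (B : nzRingType) (c d : B).

Definition quad_poly : {poly B} := 'X^2 + c%:P * 'X + d%:P.

Definition quad_ideal : {poly B} -> bool := rdvdp quad_poly.

Lemma size_quad_poly : size quad_poly = 3.
Proof.
rewrite /quad_poly -addrA size_polyDl size_polyXn // ltnS.
apply: leq_trans (size_polyD _ _) _; rewrite geq_max.
by rewrite mul_polyC (leq_trans (size_scale_leq _ _)) ?size_polyX //
           (leq_trans (size_polyC_leq1 _)).
Qed.

Lemma quad_poly_monic : quad_poly \is monic.
Proof.
rewrite monicE lead_coefE size_quad_poly /quad_poly.
by rewrite !coefD coefXn coefCM coefX coefC mulr0 !addr0.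
Qed.

Lemma quad_idealP (p : {poly B}) :
  reflect (exists q, p = q * quad_poly) (p \in quad_ideal).
Proof. exact: rdvdpP quad_poly_monic _. Qed.

Fact quad_ideal_idealr : idealr_closed quad_ideal.
Proof.
split.
- by apply/quad_idealP; exists 0; rewrite mul0r.
- apply/quad_idealP=> -[q def1].
  have: size (1 : {poly B}) = size (q * quad_poly) by rewrite -def1.
  have [q0|qN0] := eqVneq q 0.
    by rewrite q0 mul0r size_poly0 size_poly1.
  rewrite size_Mmonic ?quad_poly_monic // size_quad_poly size_poly1.
  by rewrite addnS /= addn2.
- move=> a _ _ /quad_idealP[p ->] /quad_idealP[q ->].
  by apply/quad_idealP; exists (a * p + q); rewrite mulrDl mulrA.
Qed.

HB.instance Definition _ := isIdealr.Build {poly B} quad_ideal quad_ideal_idealr.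

Hypotheses (cC : central c) (dC : central d).

Fact quad_ideal_right (p u : {poly B}) :
  u \in quad_ideal -> u * p \in quad_ideal.
Proof.
have polyC_comm (b : B) : central b -> b%:P * p = p * b%:P.
  by move=> bC; apply/polyP=> i; rewrite coefCM coefMC bC.
move=> /quad_idealP[q ->]; apply/quad_idealP; exists (q * p).
rewrite -!mulrA; congr (_ * _); rewrite /quad_poly !mulrDl !mulrDr.
rewrite -mulrA -[LHS]/('X^2 * p + c%:P * ('X * p) + d%:P * p).
by rewrite commr_polyXn -commr_polyX !mulrA !polyC_comm.
Qed.

(* B[t]/(t^2 + ct + d), a ring because c and d are central *)
Definition quad_ext : nzRingType := ring_quot quad_ideal_right.

(* The canonical map B -> A, through which A is a B-bimodule. *)
Definition quad_in (b : B) : quad_ext := ring_quot_proj quad_ideal_right b%:P.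

Definition quad_gen : quad_ext := ring_quot_proj quad_ideal_right 'X.

(* The second conjunct makes the order exactly 2. *)
Definition quad_involution (s : quad_ext -> quad_ext) : Prop :=
  [/\ involution s, ~ (s =1 id), forall b, s (quad_in b) = quad_in b &
      s quad_gen = - (quad_in c + quad_gen)].

End QuadraticExtension.

(* Main.v *)
Require Import Defs.
From HB Require Import structures.
From mathcomp Require Import all_boot all_order all_algebra.
From mathcomp Require Import generic_quotient ring_quotient.
From mathcomp Require Import boolp classical_sets.
From mathcomp Require Import ring.

(** Write [i] for the canonical map from B to A and [g] for the class of t.
    Division by the monic polynomial [t^2 + c t + d] leaves a unique remainder
    of degree at most 1, and [g] commutes with the image of B; this gives
    (a) ([quad_coordE], [quad_in_gen_eq0]).

    These coordinates also determine the involution: an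
    anti-automorphism fixing B and sending [g] to [-(c + g)] can only be
    [a + b g |-> (a - c b) - b g] ([quad_involutionE]). Conversely, when B is
    commutative, this formula replaces [g] by the other root [-(c + g)] of the
    same quadratic polynomial, so it respects products
    ([quad_conj_involution]); it moves [g] because [2 = 0] and [c = 0] cannot
    both hold.

    Every such involution has trace [a + b g |-> 2 a - c b]
    ([quad_involution_trace]), with values in B. It is onto since 2 or c is a
    unit, which is (d). For (c), let I be a left ideal of A on which
    [mu (2 a - c b) = 1]. The traces of elements of I form a left ideal of B
    inside the kernel of mu, so they all vanish. Applying this to both [x] and
    [g x], for [x = a + b g] in I, gives
      [2 a = c b]  and  [- 2 b d = c (a - b c)].
    If 2 is a unit, then c = 0 and d is a unit, so a = b = 0. If 2 is in the
    Jacobson radical, then c is a unit; eliminating [b = c^-1 2 a] gives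
    [a = r 2 a] for some r, whence a = 0 because [1 - r 2] has a left inverse
    ([quad_trace_nondegenerate]). That left inverse comes from the existence of
    maximal left ideals, hence from Zorn's lemma
    ([jacobson_radical_linv]). *)

Set Implicit Arguments.
Unset Strict Implicit.
Unset Printing Implicit Defensive.

Import GRing.Theory Pdiv.Ring Pdiv.RingMonic.

Local Open Scope ring_scope.

(** * Maximal left ideals and the Jacobson radical *)

(** Zorn's lemma applies because the union of a nonempty chain of left ideals
    omitting 1 is a left ideal omitting 1. *)
Lemma proper_left_ideal_sub_maximal (R : nzRingType) (I : R -> Prop) :
  left_ideal I -> ~ I 1 ->
  exists M, maximal_left_ideal M /\ forall x, I x -> M x.
Proof.
move=> idI I1.
pose proper_over (X : set R) :=
  [/\ left_ideal X, ~ X 1 & forall x, I x -> X x].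
(* The empty set is admitted only so that the union of the empty chain is. *)
pose P (X : set R) := (forall x, ~ X x) \/ proper_over X.
have [|M [PM maxM]] := @Zorn_bigcup _ P.
  move=> C CP totC.
  have [[X CX [x Xx]]|noX] := pselect (exists2 X, C X & exists x, X x);
    last first.
    by left=> x [X CX Xx]; apply: noX; exists X => //; exists x.
  have proper Y y : C Y -> Y y -> proper_over Y.
    by move=> CY Yy; case: (CP _ CY) => // /(_ y).
  have [[X0 _ _] _ IX] := proper _ _ CX Xx.
  right; split.
  - split.
    + by exists X.
    + move=> y z [Y CY Yy] [Z CZ Zz].
      have [[_ YD _] _ _] := proper _ _ CY Yy.
      have [[_ ZD _] _ _] := proper _ _ CZ Zz.
      by case: (totC _ _ CY CZ) => sub;
        [exists Z => //; apply: ZD => //; apply: sub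
        |exists Y => //; apply: YD => //; apply: sub].
    + move=> a y [Y CY Yy]; exists Y => //.
      by have [[_ _ YM] _ _] := proper _ _ CY Yy; apply: YM.
  - by move=> [Y CY Y1]; have [_ /(_ Y1)] := proper _ _ CY Y1.
  - by move=> y Iy; exists X => //; apply: IX.
have maxM' (J : R -> Prop) :
    proper_over J -> (forall x, M x -> J x) -> forall x, J x -> M x.
  move=> PJ MJ; apply: contrapT => nJM.
  by apply: (maxM J); [split | right].
case: PM => [M0 | [idM M1 IM]].
  have IM : forall x, I x -> M x by apply: maxM' => // x /M0.
  by have [/IM/M0] := idI.
exists M; split=> //; split=> // J idJ J1 MJ.
by apply: maxM' => //; split=> // x /IM/MJ.
Qed.

(** Otherwise [1 - r x] lies in a maximal left ideal, which also contains
    [r x], hence 1. *)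
Lemma jacobson_radical_linv (R : nzRingType) (r x : R) :
  jacobson_radical x -> exists u, u * (1 - r * x) = 1.
Proof.
move=> Jx; apply: contrapT => noinv.
have idI : left_ideal (fun y => exists u, y = u * (1 - r * x)).
  split.
  - by exists 0; rewrite mul0r.
  - by move=> _ _ [u ->] [v ->]; exists (u + v); rewrite mulrDl.
  - by move=> a _ [u ->]; exists (a * u); rewrite mulrA.
have [|M [maxM IM]] := proper_left_ideal_sub_maximal idI.
  by case=> u e; apply: noinv; exists u.
have [[_ MD MM] M1 _] := maxM; apply: M1.
rewrite -(subrK (r * x) 1); apply: MD; last exact/MM/(Jx M).
by apply: IM; exists 1; rewrite mul1r.
Qed.

(** * Roots of a quadratic equation *)

(** The product of two elements [a + b g] depends on [g] only through its
    quadratic equation, so it is the same for both roots. *)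
Lemma quad_root_mul (R : nzRingType) (c d g a b a' b' : R) :
  commutative ( *%R : R -> R -> R) -> g * g = - (c * g + d) ->
  (a + b * g) * (a' + b' * g) =
  (a * a' - b * b' * d) + (a * b' + b * a' - b * b' * c) * g.
Proof.
move=> RC; pose R' : comNzRingType := HB.pack (R : Type) R
  (GRing.PzRing_hasCommutativeMul.Build R RC).
suff mulE (x y z u v w t : R') : z * z = - (x * z + y) ->
    (u + v * z) * (w + t * z) =
    (u * w - v * t * y) + (u * t + v * w - v * t * x) * z by exact: mulE.
move=> zE; transitivity (u * w + (u * t + v * w) * z + v * t * (z * z)).
  by ring.
by rewrite zE; ring.
Qed.

Lemma quad_other_root (R : nzRingType) (c d g : R) :
  commutative ( *%R : R -> R -> R) -> g * g = - (c * g + d) ->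
  - (c + g) * - (c + g) = - (c * - (c + g) + d).
Proof.
move=> RC gE; rewrite mulrNN mulrN opprD opprK mulrDl !mulrDr (RC g c) gE.
by rewrite opprD addNKr.
Qed.

(** * Coordinates in the basis 1, g *)

Section QuadraticExtensionTheory.

Variables (B : nzRingType) (c d : B) (cC : central c) (dC : central d).

Local Notation A := (quad_ext cC dC).
Local Notation i := (quad_in cC dC).
Local Notation g := (quad_gen cC dC).
Local Notation f := (quad_poly c d).
Local Notation Q0 := (Quotient.quot (quad_ideal c d : idealr {poly B})).
Local Notation proj := (ring_quot_proj (quad_ideal_right cC dC)).

Fact quad_in_zmod : zmod_morphism i.
Proof. by move=> a b; rewrite /quad_in polyCB raddfB. Qed.

Fact quad_in_monoid : monoid_morphism i.
Proof. by split=> [|a b]; rewrite /quad_in ?polyCM ?rmorphM ?rmorph1. Qed.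

HB.instance Definition _ := GRing.isZmodMorphism.Build B A i quad_in_zmod.
HB.instance Definition _ := GRing.isMonoidMorphism.Build B A i quad_in_monoid.

Lemma quad_gen_comm (b : B) : g * i b = i b * g.
Proof. by rewrite /quad_in /quad_gen -!rmorphM commr_polyX. Qed.

Lemma quad_gen_sqr : g * g = - (i c * g + i d).
Proof.
apply/eqP; rewrite -addr_eq0 addrA /quad_in /quad_gen -!(rmorphM proj).
rewrite -!(rmorphD proj) -(rmorph0 proj); apply/eqP/ring_quot_projP.
by rewrite subr0; apply/quad_idealP; exists 1; rewrite mul1r.
Qed.

(** The remainder in the division by the monic quadratic does not depend on
    the representative. *)
Definition quad_coord (x : A) : B * B :=
  let r := rmodp (repr (x : Q0)) f in (r`_0, r`_1).

Lemma quad_coordE (x : A) : x = i (quad_coord x).1 + i (quad_coord x).2 * g.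
Proof.
rewrite /quad_in /quad_gen -(rmorphM proj) -(rmorphD proj) /=.
rewrite -{1}[x](@reprK _ Q0).
apply/ring_quot_projP/quad_idealP.
set p := repr _; exists (rdivp p f).
suff -> : ((rmodp p f)`_0)%:P + ((rmodp p f)`_1)%:P * 'X = rmodp p f.
  by rewrite {1}(rdivp_eq (quad_poly_monic c d) p) addrK.
have := ltn_rmodpN0 p (monic_neq0 (quad_poly_monic c d)).
rewrite size_quad_poly => lt_size; apply/polyP=> -[|[|k]];
  rewrite coefD coefC coefCM coefX /= ?mulr0 ?addr0 ?mulr1 ?add0r //.
by rewrite nth_default // -ltnS (leq_trans lt_size).
Qed.

(** A nonzero multiple of the monic quadratic has degree at least 2, too large
    for [a + b t]. *)
Lemma quad_in_gen_eq0 (a b : B) : i a + i b * g = 0 -> a = 0 /\ b = 0.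
Proof.
rewrite /quad_in /quad_gen -(rmorphM proj) -(rmorphD proj) /=.
rewrite -(rmorph0 proj) => /ring_quot_projP; rewrite subr0 => /quad_idealP[q].
have [-> | q_neq0] := eqVneq q 0.
  rewrite mul0r => e0.
  have e k : (a%:P + b%:P * 'X : {poly B})`_k = 0 by rewrite e0 coef0.
  move: (e 0%N) (e 1%N); rewrite !coefD !coefC !coefCM !coefX /=.
  by rewrite mulr0 addr0 mulr1 add0r.
move=> /(congr1 (fun p : {poly B} => size p)).
rewrite size_Mmonic ?quad_poly_monic // size_quad_poly addnS /= addn2 => size_e.
have : (size (a%:P + b%:P * 'X)%R <= 2)%N.
  apply: leq_trans (size_polyD _ _) _; rewrite geq_max.
  by rewrite mul_polyC (leq_trans (size_scale_leq _ _)) ?size_polyX //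
             (leq_trans (size_polyC_leq1 _)).
by rewrite size_e !ltnS leqn0 size_poly_eq0 (negPf q_neq0).
Qed.

Lemma quad_coordK (a b : B) : quad_coord (i a + i b * g) = (a, b).
Proof.
have /esym/eqP := quad_coordE (i a + i b * g).
rewrite -subr_eq0 opprD addrACA -mulrBl -!rmorphB => /eqP/quad_in_gen_eq0.
case=> /eqP; rewrite subr_eq0 => /eqP ea /eqP; rewrite subr_eq0 => /eqP eb.
by rewrite [LHS]surjective_pairing ea eb.
Qed.

Lemma quad_coord_ind (P : A -> Prop) :
  (forall a b, P (i a + i b * g)) -> forall x, P x.
Proof. by move=> Pab x; rewrite [x]quad_coordE; apply: Pab. Qed.

Lemma quad_coordD (x y : A) : quad_coord (x + y) = quad_coord x + quad_coord y.
Proof.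
elim/quad_coord_ind: x => a b; elim/quad_coord_ind: y => a' b'.
by rewrite addrACA -mulrDl -!rmorphD !quad_coordK.
Qed.

Lemma quad_gen_mull (a b : B) :
  g * (i a + i b * g) = i (- (b * d)) + i (a - b * c) * g.
Proof.
rewrite mulrDr mulrA !quad_gen_comm -mulrA quad_gen_sqr mulrN mulrDr opprD.
rewrite rmorphN rmorphB !rmorphM mulrBl mulrA.
by rewrite addrA addrC.
Qed.

(** * The involution *)

Section InvolutionFormula.

Variable s : A -> A.
Hypothesis s_invol : quad_involution s.

Lemma quad_involutionE (a b : B) :
  s (i a + i b * g) = i (a - c * b) - i b * g.
Proof.
have [[sD _ sM _] _ sB sg] := s_invol.
rewrite sD sM !sB sg mulNr mulrDl quad_gen_comm rmorphB rmorphM.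
by rewrite opprD addrA.
Qed.

Lemma quad_involution_trace (a b : B) :
  (i a + i b * g) + s (i a + i b * g) = i (2 * a - c * b).
Proof.
by rewrite quad_involutionE addrACA subrr addr0 -rmorphD addrA mulr_natl mulr2n.
Qed.

End InvolutionFormula.

Lemma quad_involution_unique (s s' : A -> A) :
  quad_involution s -> quad_involution s' -> s' =1 s.
Proof.
by move=> sP sP'; elim/quad_coord_ind=> a b; rewrite !quad_involutionE.
Qed.

(** Conjugation in the quadratic extension: evaluation at [-(c + g)], the root
    complementary to [g] since the two add up to [-c]. *)
Definition quad_conj (x : A) : A :=
  i (quad_coord x).1 + i (quad_coord x).2 * - (i c + g).

Lemma quad_conjE (a b : B) :
  quad_conj (i a + i b * g) = i a + i b * - (i c + g).
Proof. by rewrite /quad_conj quad_coordK. Qed.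

Lemma quad_ext_comm :
  commutative ( *%R : B -> B -> B) -> commutative ( *%R : A -> A -> A).
Proof.
move=> BC; elim/ring_quot_ind=> p; elim/ring_quot_ind=> q.
rewrite -!(rmorphM proj); congr proj; apply/polyP=> k.
by rewrite coefM coefMr; apply: eq_bigr => j _; apply: BC.
Qed.

Lemma quad_conj_involution :
  commutative ( *%R : B -> B -> B) -> (2 != 0 :> B) || (c != 0) ->
  quad_involution quad_conj.
Proof.
move=> BC nz.
have AC := quad_ext_comm BC.
have hE := quad_other_root AC quad_gen_sqr.
have gN : g = i 0 + i 1 * g by rewrite rmorph0 rmorph1 mul1r add0r.
split.
- split.
  + elim/quad_coord_ind=> a b; elim/quad_coord_ind=> a' b'.
    by rewrite addrACA -mulrDl -!rmorphD !quad_conjE !rmorphD mulrDl addrACA.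
  + have -> : 1 = i 1 + i 0 * g by rewrite rmorph0 mul0r addr0 rmorph1.
    by rewrite quad_conjE rmorph0 !mul0r.
  + elim/quad_coord_ind=> a b; elim/quad_coord_ind=> a' b'; rewrite !quad_conjE.
    rewrite (quad_root_mul _ _ _ _ AC quad_gen_sqr) [RHS]AC.
    rewrite (quad_root_mul _ _ _ _ AC hE).
    by rewrite -!(rmorphM i) -!(rmorphD i) -!(rmorphB i) quad_conjE.
  + elim/quad_coord_ind=> a b; rewrite quad_conjE.
    have -> : i a + i b * - (i c + g) = i (a - b * c) + i (- b) * g.
      by rewrite rmorphB rmorphN rmorphM mulrN mulNr mulrDr opprD addrA.
    rewrite quad_conjE rmorphB rmorphN rmorphM mulrNN mulrDr.
    by rewrite addrA subrK.
(* A fixed g would give c + 2 g = 0, hence c = 0 and 2 = 0. *)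
- move=> /(_ g); rewrite {1}gN quad_conjE.
  rewrite rmorph0 rmorph1 mul1r add0r => /eqP.
  rewrite eq_sym -subr_eq0 opprK addrC -addrA -mulr2n -mulr_natl.
  rewrite -[2]/(2%:R) -(rmorph_nat i) => /eqP/quad_in_gen_eq0[c0 two0].
  by move: nz; rewrite c0 two0 eqxx.
- move=> b; have {1}-> : i b = i b + i 0 * g.
    by rewrite rmorph0 mul0r addr0.
  by rewrite quad_conjE rmorph0 !mul0r addr0.
- by rewrite {1}gN quad_conjE rmorph0 rmorph1 mul1r add0r.
Qed.

(** * The trace form *)

(** Traces of elements of a left ideal of A form a left ideal of B, and
    primitivity of mu kills it. *)
Lemma quad_trace_kernel (F : fieldType) (mu : B -> F) (s : A -> A)
    (lam : A -> F) (I : A -> Prop) :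
  left_primitive mu -> quad_involution s ->
  (forall a b, lam (i a + i b * g) = mu a) ->
  left_ideal I -> (forall x, I x -> sharp s lam x = 1) ->
  forall a b, I (i a + i b * g) -> 2 * a = c * b.
Proof.
move=> [_ mu_ker] sP lamE [I0 ID IM] I_ker a0 b0 Iab0.
pose J (y : B) := exists a b, I (i a + i b * g) /\ y = 2 * a - c * b.
have idJ : left_ideal J.
  split.
  - by exists 0, 0; split; rewrite ?mulr0 ?subr0 // rmorph0 mul0r addr0.
  - move=> _ _ [a [b [Iab ->]]] [a' [b' [Iab' ->]]].
    exists (a + a'), (b + b'); split; last by rewrite !mulrDr opprD addrACA.
    by rewrite !rmorphD mulrDl addrACA; apply: ID.
  - move=> r _ [a [b [Iab ->]]]; exists (r * a), (r * b); split.
      by rewrite !rmorphM -!mulrA -mulrDr; apply: IM.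
    by rewrite mulrBr !mulrA (cC r) -!(commr_nat r 2).
apply/eqP; rewrite -subr_eq0; apply/eqP.
apply: (mu_ker J) => //; last by exists a0, b0.
move=> _ [a [b [Iab ->]]]; rewrite -(I_ker _ Iab) /sharp.
rewrite quad_involution_trace // -[i _]addr0 -[0](mul0r g) -(rmorph0 i).
by rewrite lamE.
Qed.

End QuadraticExtensionTheory.

(** The two equations say that [a + b g] and [g (a + b g)] both have trace
    zero. *)
Lemma quad_trace_nondegenerate (B : unitRingType) (c d a b : B) :
  central c -> central d ->
  ((2 : B) \is a GRing.unit /\ c = 0 /\ d \is a GRing.unit) \/
  (jacobson_radical (2 : B) /\ c \is a GRing.unit) ->
  2 * a = c * b -> - (2 * (b * d)) = c * (a - b * c) -> a = 0 /\ b = 0.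
Proof.
move=> cC dC [[U2 [-> Ud]] | [J2 Uc]] e1 e2.
  move: e1 e2; rewrite !mul0r => e1 /eqP; rewrite oppr_eq0 => /eqP e2.
  split; first by apply: (mulrI U2); rewrite mulr0.
  by apply: (mulIr Ud); apply: (mulrI U2); rewrite mul0r mulr0.
have bE : b = c^-1 * (2 * a) by rewrite e1 mulKr.
have aE : a = 2 * a - c^-1 * (2 * (b * d)).
  by rewrite -mulrN e2 mulKr // e1 (cC b) addrC subrK.
(* [aE] with b eliminated; d commutes past [2 a]. *)
pose r := 1 - c^-1 * 2 * c^-1 * d.
have arE : a = r * (2 * a).
  rewrite {1}aE /r mulrBl mul1r; congr (_ - _).
  by rewrite bE -[in LHS]mulrA -(dC (2 * a)) !mulrA.
have [u uE] := jacobson_radical_linv r J2.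
have a0 : a = 0.
  rewrite -[a]mul1r -uE -mulrA mulrBl mul1r -[r * 2 * a]mulrA -arE.
  by rewrite subrr mulr0.
by split; rewrite // bE a0 !mulr0.
Qed.

Theorem lemma5p6 (F : fieldType) (B : unitRingType) (mu : B -> F) (c d : B)
    (mu_prim : left_primitive mu)
    (two_cases : (2 : B) \is a GRing.unit \/ jacobson_radical (2 : B))
    (cC : central c) (dC : central d)
    (two_unit : (2 : B) \is a GRing.unit -> c = 0 /\ d \is a GRing.unit)
    (two_rad : jacobson_radical (2 : B) -> c \is a GRing.unit) :
  let A := quad_ext cC dC in
  let i : B -> A := quad_in cC dC in
  let gamma : A := quad_gen cC dC in
  [/\ (* (a) *)
      (forall x : A, exists! ab : B * B, x = i ab.1 * 1 + i ab.2 * gamma) /\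
      (forall x : A, exists! ab : B * B, x = 1 * i ab.1 + gamma * i ab.2),
      (* (b) existence presupposes that the identity of B is an involution *)
      commutative ( *%R : B -> B -> B) ->
        exists s : A -> A, quad_involution s /\
          (forall s' : A -> A, quad_involution s' -> s' =1 s),
      (* (c) *)
      forall s : A -> A, quad_involution s ->
        exists lam : A -> F,
          (forall a b : B, lam (i a + i b * gamma) = mu a) /\
          left_admissible s lam
    & (* (d) *)
      forall s : A -> A, quad_involution s ->
        (forall x : A, exists b : B, x + s x = i b) /\
        (forall b : B, exists x : A, x + s x = i b)].
Proof.
have [[mu_neq0 muD] _] := mu_prim; cbv zeta.
have unit_or_rad :
    ((2 : B) \is a GRing.unit /\ c = 0 /\ d \is a GRing.unit) \/
    (jacobson_radical (2 : B) /\ c \is a GRing.unit).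
  by case: two_cases => h; [left; split => //; apply: two_unit
                           |right; split => //; apply: two_rad].
have coord x : exists! ab : B * B,
    x = quad_in cC dC ab.1 + quad_in cC dC ab.2 * quad_gen cC dC.
  exists (quad_coord x); split; first exact: quad_coordE.
  by case=> a b /= ->; rewrite quad_coordK.
split.
- split=> x; have [ab [xE ab_uniq]] := coord x; exists ab.
    by split=> [|ab']; rewrite mulr1 //; apply: ab_uniq.
  by split=> [|ab']; rewrite mul1r quad_gen_comm //; apply: ab_uniq.
- move=> BC; exists (@quad_conj B c d cC dC).
  have sP : quad_involution (@quad_conj B c d cC dC).
    apply: quad_conj_involution BC _.
    case: unit_or_rad => [[U2 _] | [_ Uc]]; apply/orP.
      by left; apply: contraTneq U2 => ->; rewrite unitr0.
    by right; apply: contraTneq Uc => ->; rewrite unitr0.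
  by split=> // s' sP'; apply: quad_involution_unique.
- move=> s sP; pose lam (x : quad_ext cC dC) := mu (quad_coord x).1.
  have lamE a b :
      lam (quad_in cC dC a + quad_in cC dC b * quad_gen cC dC) = mu a.
    by rewrite /lam quad_coordK.
  exists lam; split=> //; split.
    split=> [x | x y]; first exact: mu_neq0.
    by rewrite /lam quad_coordD -muD.
  move=> I idI I_ker; have J0 := quad_trace_kernel mu_prim sP lamE idI I_ker.
  elim/quad_coord_ind=> a b Iab.
  have [_ _ IM] := idI.
  have Igab := IM (quad_gen cC dC) _ Iab; rewrite quad_gen_mull in Igab.
  have [|-> ->] := quad_trace_nondegenerate cC dC unit_or_rad (J0 _ _ Iab).
    by rewrite -mulrN; apply: J0.
  by rewrite rmorph0 mul0r addr0.
- move=> s sP; split=> [|b].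
    elim/quad_coord_ind=> a b; exists (2 * a - c * b).
    exact: quad_involution_trace.
  case: unit_or_rad => [[U2 [c0 _]] | [_ Uc]].
    exists (quad_in cC dC (2^-1 * b) + quad_in cC dC 0 * quad_gen cC dC).
    by rewrite quad_involution_trace // mulr0 subr0 mulVKr.
  exists (quad_in cC dC 0 + quad_in cC dC (- (c^-1 * b)) * quad_gen cC dC).
  by rewrite quad_involution_trace // mulr0 add0r mulrN opprK mulVKr.
Qed.
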